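(* Let $k$ be an arbitrary field, let $\omega=h(u,v)\,du\wedge dv$ with $h\in k((u))((v))$ be a formal $2$-form, and let $(x,y)$ be a pair of elements of $k((u))((v))$ connected with $(u,v)$ by a change of variables of the form $$u=f(x,y),\qquad v=g(x,y),$$ where $f\in k((x))[[y]]$ satisfies $f(x,0)\in xk[[x]]\smallsetminus x^2k[[x]]$ and $g\in yk((x))[[y]]\smallsetminus y^2k((x))[[y]]$. Then $$(u,v)\mathrm{res}^2_{C,P}(\omega)=(x,y)\mathrm{res}^2_{C,P}(\omega).$$
   Context: Setting: $k$ is an arbitrary field of arbitrary characteristic, $S$ a smooth geometrically integral quasi-projective surface over $k$, $C\subset S$ an irreducible geometrically reduced curve and $P$ a smooth $k$-rational point of $C$. The subscripts $C,P$ only indicate the geometric origin of the variables; the quantities in the theorem are purely formal, as follows. A formal $2$-form is an expression $\omega=h\,du\wedge dv$ with $h\in k((u))((v))$. Write $h=\sum_{j\ge -l}h_j(u)v^j$ with $h_j(u)=\sum_i h_{j,i}u^i\in k((u))$. The $(u,v)$-$2$-residue is the coefficient of $u^{-1}v^{-1}$ in $h$: $(u,v)\mathrm{res}^2_{C,P}(\omega):=h_{-1,-1}\in k$. For $f,g$ as in the claim, the substitution $u\mapsto f(x,y)$, $v\mapsto g(x,y)$ gives a well-defined morphism $k((u))((v))\to k((x))((y))$, $h\mapsto h(f,g)$. (On $k((x))[[y]]$ one uses the topology in which a sequence $\sum_j s_j^{(n)}(x)y^j$ tends to $0$ if and only if, for each $j$, $s_j^{(n)}(x)\to 0$ for the $(x)$-adic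 topology; the series obtained by substituting $f,g$ converge for it.) Under the change of variables, the form $\omega$ becomes $$\omega=h(f,g)\left(\frac{\partial f}{\partial x}\frac{\partial g}{\partial y}-\frac{\partial f}{\partial y}\frac{\partial g}{\partial x}\right)dx\wedge dy,$$ and $(x,y)\mathrm{res}^2_{C,P}(\omega)$ is the coefficient of $x^{-1}y^{-1}$ in the coefficient in $k((x))((y))$ of $dx\wedge dy$ in this expression. *)

(* Defs.v *)
From HB Require Import structures.
From mathcomp Require Import all_boot all_order all_algebra zify.
From mathcomp Require Import boolp classical_sets functions cardinality fsbigop.
From mathcomp Require Import topology.

Set Implicit Arguments.
Unset Strict Implicit.
Unset Printing Implicit Defensive.
Import Order.TTheory GRing.Theory Num.Theory.
Local Open Scope classical_set_scope.
Local Open Scope ring_scope.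

Reserved Notation "{ 'laurent' R }" (format "{ 'laurent'  R }").

(* A formal Laurent series over R is its coefficient function, which vanishes
   below some integer.  Thus k((x))((y)) is {laurent {laurent k}}, the outer
   variable being y: the coefficient of x^i y^j in F is F j i. *)
Record laurent (R : comNzRingType) := Laurent {
  lcoef :> int -> R;
  lcoefP : exists N : int, forall i, i < N -> lcoef i = 0 }.

Notation "{ 'laurent' R }" := (laurent R) : type_scope.

Section LaurentRing.
Variable R : comNzRingType.
Implicit Types a b c : {laurent R}.

Lemma laurentP a b : (forall i, a i = b i) -> a = b.
Proof.
case: a b => [a aP] [b bP] /= /funext eab.
by case: _ / eab bP => bP; congr Laurent; exact: Prop_irrelevance.
Qed.

HB.instance Definition _ := gen_eqMixin {laurent R}.
HB.instance Definition _ := gen_choiceMixin {laurent R}.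

Lemma lcoef_bound a : exists N : nat, forall i : int, i < - N%:Z -> a i = 0.
Proof.
by have [N NP] := lcoefP a; exists `|N|%N => i iN; apply: NP; lia.
Qed.

Lemma lzero_subproof : exists N : int, forall i, i < N -> (fun=> 0 : R) i = 0.
Proof. by exists 0. Qed.
Definition lzero : {laurent R} := Laurent lzero_subproof.

Lemma lopp_subproof a : exists N : int, forall i, i < N -> - a i = 0.
Proof. by have [N aN] := lcoefP a; exists N => i /aN->; rewrite oppr0. Qed.
Definition lopp a : {laurent R} := Laurent (lopp_subproof a).

Lemma ladd_subproof a b : exists N : int, forall i, i < N -> a i + b i = 0.
Proof.
have [N aN] := lcoef_bound a; have [M bM] := lcoef_bound b.
by exists (- (N + M)%N%:Z) => i iN; rewrite aN ?bM ?addr0//; lia.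
Qed.
Definition ladd a b : {laurent R} := Laurent (ladd_subproof a b).

Lemma laddA : associative ladd.
Proof. by move=> a b c; apply: laurentP => i /=; rewrite addrA. Qed.
Lemma laddC : commutative ladd.
Proof. by move=> a b; apply: laurentP => i /=; rewrite addrC. Qed.
Lemma ladd0 : left_id lzero ladd.
Proof. by move=> a; apply: laurentP => i /=; rewrite add0r. Qed.
Lemma laddN : left_inverse lzero lopp ladd.
Proof. by move=> a; apply: laurentP => i /=; rewrite addNr. Qed.

HB.instance Definition _ :=
  GRing.isZmodule.Build {laurent R} laddA laddC ladd0 laddN.

(* The window [-N, L - N) of integers. *)
Definition window (N L : nat) : seq int := [seq i%:Z - N%:Z | i <- iota 0 L].

Lemma window_uniq N L : uniq (window N L).
Proof. by rewrite map_inj_uniq ?iota_uniq// => i j; lia. Qed.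

Lemma mem_window N L (i : int) :
  (i \in window N L) = (- N%:Z <= i < L%:Z - N%:Z).
Proof.
apply/mapP/idP => [[j]|iNL].
  by rewrite mem_iota => jL ->; lia.
by exists (absz (i + N%:Z)); rewrite ?mem_iota; lia.
Qed.

Lemma fsum_window (F : int -> R) N L :
  (forall i, i \notin window N L -> F i = 0) ->
  \sum_(i \in setT) F i = \sum_(i <- window N L) F i.
Proof.
move=> F0; rewrite (fsbigE (window N L)) ?window_uniq//; last by move=> i _ /F0.
by apply: eq_bigl => i; rewrite in_setT.
Qed.

(* The sum has finite support, hence the finitely supported big operator. *)
Definition lmul_coef (a b : int -> R) (n : int) : R :=
  \sum_(i \in [set: int]) a i * b (n - i).

Lemma lmul_coef_window (a b : int -> R) (n : int) (N M L : nat) :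
  (forall i : int, i < - N%:Z -> a i = 0) ->
  (forall i : int, i < - M%:Z -> b i = 0) -> n + N%:Z + M%:Z < L%:Z ->
  lmul_coef a b n = \sum_(i <- window N L) a i * b (n - i).
Proof.
move=> aN bM nL; apply: fsum_window => i; rewrite mem_window => iNL.
have [iN|iN] := ltP i (- N%:Z); first by rewrite aN ?mul0r.
by rewrite bM ?mulr0//; lia.
Qed.

Lemma lmul_subproof a b :
  exists N : int, forall i, i < N -> lmul_coef a b i = 0.
Proof.
have [N aN] := lcoef_bound a; have [M bM] := lcoef_bound b.
exists (- (N + M)%N%:Z) => n nN.
by rewrite (@lmul_coef_window _ _ n N M 0)// ?big_nil//; lia.
Qed.
Definition lmul a b : {laurent R} := Laurent (lmul_subproof a b).

Lemma lconst_subproof (c : R) :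
  exists N : int, forall i, i < N -> (if i == 0 then c else 0) = 0.
Proof. by exists 0 => i /lt_eqF->. Qed.
Definition lconst (c : R) : {laurent R} := Laurent (lconst_subproof c).

Lemma lmulC : commutative lmul.
Proof.
move=> a b; apply: laurentP => n /=; rewrite /lmul_coef.
rewrite (reindex_fsbigT (fun i : int => n - i)); last first.
  by exists (fun i : int => n - i) => i; lia.
by apply: eq_fsbigr => i _; rewrite mulrC; congr (b _ * a _); lia.
Qed.

Lemma lmulCA a b c : lmul a (lmul c b) = lmul c (lmul a b).
Proof.
have [Na aN] := lcoef_bound a; have [Nb bN] := lcoef_bound b.
have [Nc cN] := lcoef_bound c; pose N := (Na + Nb + Nc)%N.
have {}aN i : i < - N%:Z -> a i = 0 by move=> ?; apply: aN; lia.
have {}bN i : i < - N%:Z -> b i = 0 by move=> ?; apply: bN; lia.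
have {}cN i : i < - N%:Z -> c i = 0 by move=> ?; apply: cN; lia.
suff E (a' b' c' : {laurent R}) n :
    (forall i, i < - N%:Z -> a' i = 0) -> (forall i, i < - N%:Z -> b' i = 0) ->
    (forall i, i < - N%:Z -> c' i = 0) ->
    lmul a' (lmul c' b') n = \sum_(i <- window N (`|n| + 4 * N).+1)
      \sum_(j <- window N (`|n| + 4 * N).+1) a' i * (c' j * b' (n - i - j)).
  apply: laurentP => n; rewrite !E// exchange_big; apply: eq_bigr => i _ /=.
  by apply: eq_bigr => j _; rewrite mulrCA; do 2!congr (_ * _); congr (b _); lia.
move=> a'N b'N c'N; rewrite [LHS](@lmul_coef_window _ _ n N (N + N)%N
  (`|n| + 4 * N).+1).
- apply: eq_big_seq => i; rewrite mem_window => iN.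
  rewrite /= (@lmul_coef_window _ _ _ N N (`|n| + 4 * N).+1) ?mulr_sumr//.
  by lia.
- exact: a'N.
- move=> i iN /=; rewrite (@lmul_coef_window _ _ _ N N 0) ?big_nil//; lia.
- lia.
Qed.

Lemma lmulA : associative lmul.
Proof. by move=> a b c; rewrite (lmulC (lmul a b)) (lmulCA c b a) (lmulC c). Qed.

Lemma lconst_mul_coef (c : R) a n : lmul (lconst c) a n = c * a n.
Proof.
have [N aN] := lcoef_bound a.
rewrite [LHS](@lmul_coef_window _ _ n 0 N (`|n| + N).+1)//; first last.
- by lia.
- by move=> i; rewrite oppr0 => /lt_eqF /= ->.
rewrite (bigD1_seq 0) ?window_uniq ?mem_window//= subr0 big1 ?addr0// => i.
by move=> /negPf->; rewrite mul0r.
Qed.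

Lemma lmul1 : left_id (lconst 1) lmul.
Proof. by move=> a; apply: laurentP => n; rewrite lconst_mul_coef mul1r. Qed.

Lemma lmulDl : left_distributive lmul ladd.
Proof.
move=> a b c; apply: laurentP => n.
have [Na aN] := lcoef_bound a; have [Nb bN] := lcoef_bound b.
have [Nc cN] := lcoef_bound c; pose N := (Na + Nb + Nc)%N.
have {}aN i : i < - N%:Z -> a i = 0 by move=> ?; apply: aN; lia.
have {}bN i : i < - N%:Z -> b i = 0 by move=> ?; apply: bN; lia.
have {}cN i : i < - N%:Z -> c i = 0 by move=> ?; apply: cN; lia.
have nL : n + N%:Z + N%:Z < (`|n| + 2 * N).+1%:Z by lia.
rewrite /= !(lmul_coef_window (N := N) (M := N) _ _ nL)//.
  by rewrite -big_split; apply: eq_bigr => i _; rewrite mulrDl.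
by move=> i iN /=; rewrite aN ?bN ?addr0.
Qed.

Lemma lone_neq0 : lconst 1 != 0 :> {laurent R}.
Proof.
apply/eqP => /(congr1 (fun a : {laurent R} => a 0)) /= /eqP.
by rewrite oner_eq0.
Qed.

HB.instance Definition _ :=
  GRing.Zmodule_isComNzRing.Build {laurent R} lmulA lmulC lmul1 lmulDl lone_neq0.

Lemma lcoef0 i : (0 : {laurent R}) i = 0. Proof. by []. Qed.
Lemma lcoefD a b i : (a + b) i = a i + b i. Proof. by []. Qed.
Lemma lcoefN a i : (- a) i = - a i. Proof. by []. Qed.
Lemma lcoef1 i : (1 : {laurent R}) i = if i == 0 then 1 else 0. Proof. by []. Qed.
Lemma lcoefM a b n : (a * b) n = \sum_(i \in [set: int]) a i * b (n - i).
Proof. by []. Qed.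

End LaurentRing.

Section LaurentField.
Variable F : fieldType.
Implicit Types a b : {laurent F}.

Section InverseSeries.
Variable s : nat -> F.

Fixpoint inv_series_upto (n : nat) : nat -> F :=
  if n isn't n'.+1 then fun=> 0
  else fun m => if m == n' then
      (s 0%N)^-1 * ((n' == 0%N)%:R
        - \sum_(i < n') s i.+1 * inv_series_upto n' (n' - i.+1)%N)
    else inv_series_upto n' m.

Definition inv_series n := inv_series_upto n.+1 n.

Lemma inv_series_uptoE n m : (m < n)%N -> inv_series_upto n m = inv_series m.
Proof.
elim: n => //= n IHn; rewrite ltnS leq_eqVlt => /orP[/eqP->|mn].
  by rewrite /inv_series /= eqxx.
by rewrite (ltn_eqF mn) IHn.
Qed.

Lemma inv_seriesP n : s 0%N != 0 ->
  \sum_(i < n.+1) s i * inv_series (n - i)%N = (n == 0%N)%:R.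
Proof.
move=> s0; rewrite big_ord_recl /= subn0 {1}/inv_series /= eqxx mulrA divff//.
pose r := \sum_(i < n) s i.+1 * inv_series_upto n (n - i.+1).
rewrite mul1r -[RHS](subrK r).
congr (_ + _); apply: eq_bigr => i _; rewrite [in LHS]/bump /= add1n inv_series_uptoE//.
by case: i => i /=; lia.
Qed.

End InverseSeries.

Lemma laurent_inv_ex a : a != 0 -> exists b, b * a = 1.
Proof.
move=> a0; have [N aN] := lcoef_bound a.
have /ex_minnP[n an nmin] : exists n : nat, a (n%:Z - N%:Z) != 0.
  apply: contrapT => /forallNP H; move/eqP: a0; apply; apply: laurentP => i.
  have [/aN//|iN] := ltP i (- N%:Z).
  have := H (absz (i + N%:Z)); have -> : (absz (i + N%:Z))%:Z - N%:Z = i by lia.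
  by move=> /negP; rewrite negbK => /eqP.
pose v : int := n%:Z - N%:Z.
have av i : i < v -> a i = 0.
  move=> iv; have [/aN//|iN] := ltP i (- N%:Z); apply/eqP.
  apply: contraT => ai; have := nmin (absz (i + N%:Z)).
  have -> : (absz (i + N%:Z))%:Z - N%:Z = i by lia.
  by move=> /(_ ai); lia.
pose s (t : nat) := a (v + t%:Z).
have s0 : s 0%N != 0 by rewrite /s addr0.
pose bc (j : int) := if 0 <= j + v then inv_series s (absz (j + v)) else 0.
have bP : exists M : int, forall i, i < M -> bc i = 0.
  by exists (- v) => i iv; rewrite /bc ifF//; lia.
exists (Laurent bP); rewrite mulrC; apply: laurentP => m; rewrite lcoefM lcoef1.
pose L := absz (Num.max 0 (m + 1)).
rewrite (@fsbigE _ _ _ _ _ [seq v + i%:Z | i <- iota 0 L]) //.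
- transitivity
    (\sum_(i <- iota 0 L) a (v + i%:Z) * bc (m - (v + i%:Z))).
    by rewrite big_map; apply: eq_bigl => i; rewrite in_setT.
  have [m0|m0] := ltP m 0.
    have -> : L = 0%N by rewrite /L; lia.
    by rewrite big_nil ifF//; lia.
  have -> : L = `|m|.+1 by rewrite /L; lia.
  rewrite -[iota _ _]/(index_iota 0 `|m|.+1) big_mkord.
  transitivity ((`|m|%N == 0%N)%:R : F); last first.
    have -> : (`|m|%N == 0%N) = (m == 0) by lia.
    by case: eqP.
  rewrite -(inv_seriesP _ s0); apply: eq_bigr => i _; rewrite /s /bc /=.
  by congr (_ * _); rewrite ifT; [congr inv_series|]; case: i => i /=; lia.
- by rewrite map_inj_uniq ?iota_uniq// => i j; lia.
- move=> i _ im; have [/av->|vi] := ltP i v; first by rewrite mul0r.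
  rewrite /= /bc; case: ifP => [h|_]; last by rewrite mulr0.
  case/negP: im; apply/mapP; exists (absz (i - v)); rewrite ?mem_iota /L; lia.
Qed.

Definition linv a : {laurent F} := xget 0 [set b | b * a = 1].

Lemma lmulVf a : a != 0 -> linv a * a = 1.
Proof.
by move=> /laurent_inv_ex[b ba]; rewrite /linv; case: xgetP => // /(_ b).
Qed.

Lemma linv0 : linv 0 = 0.
Proof.
apply: xgetPN => b /=; rewrite mulr0 => /esym/eqP; exact/negP/oner_neq0.
Qed.

HB.instance Definition _ :=
  GRing.ComNzRing_isField.Build {laurent F} lmulVf linv0.

End LaurentField.

(* The set t^n R[[t]], as a subset of R((t)).  In k((x))((y)), membership of F
   in k((x))[[y]] is tpow_series 0 F, and F(x, 0) is then F 0. *)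
Definition tpow_series (R : comNzRingType) (n : int) : set {laurent R} :=
  [set a | forall i, i < n -> a i = 0].

Lemma lderiv_subproof (R : comNzRingType) (a : {laurent R}) :
  exists N : int, forall i, i < N -> a (i + 1) *~ (i + 1) = 0.
Proof.
by have [N aN] := lcoefP a; exists (N - 1) => i iN; rewrite aN ?mul0rz//; lia.
Qed.
Definition lderiv (R : comNzRingType) (a : {laurent R}) : {laurent R} :=
  Laurent (lderiv_subproof a).

Section TwoVariables.
Variable k : fieldType.
Implicit Types F G : {laurent {laurent k}}.

Lemma dx_subproof F : exists N : int, forall j, j < N -> lderiv (F j) = 0.
Proof.
have [N FN] := lcoefP F; exists N => j /FN ->.
by apply: laurentP => i /=; rewrite mul0rz.
Qed.
Definition dx F : {laurent {laurent k}} := Laurent (dx_subproof F).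
Definition dy F : {laurent {laurent k}} := lderiv F.

Definition jacobian F G := dx F * dy G - dy F * dx G.

Definition xadic_to0 (s : nat -> {laurent k}) :=
  forall N : int, \forall n \near \oo, tpow_series N (s n).

(* Convergence in y^l k((x))[[y]] for some l, where this set carries the
   topology of k((x))[[y]] translated by multiplication by y^l. *)
Definition seq_to0 (S : nat -> {laurent {laurent k}}) :=
  (exists l : int, forall n, tpow_series l (S n)) /\
  (forall j : int, xadic_to0 (fun n => S n j)).

Definition seq_cvg (S : nat -> {laurent {laurent k}}) F :=
  seq_to0 (fun n => S n - F).

Lemma seq_cvg_unique S F G : seq_cvg S F -> seq_cvg S G -> F = G.
Proof.
move=> [_ SF] [_ SG]; apply: laurentP => j; apply: laurentP => i.
have [p _ pP] := filterI (SF j (i + 1)) (SG j (i + 1)).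
have [/(_ i) Fi /(_ i) Gi] := pP p (leqnn p).
have /eqP := Fi ltac:(lia); have /eqP := Gi ltac:(lia).
by rewrite /= !subr_eq0 => /eqP<- /eqP<-.
Qed.

(* The sum over i in Z of t i, for a family t vanishing for i << 0, and 0 if
   the series does not converge. *)
Definition lsum (t : int -> {laurent {laurent k}}) : {laurent {laurent k}} :=
  xget 0 [set F | seq_cvg (fun n => \sum_(i < n.*2) t (i%:Z - n%:Z)) F].

(* a(f) for a in k((u)), and h(f, g) for h in k((u))((v)). *)
Definition subst1 (a : {laurent k}) F : {laurent {laurent k}} :=
  lsum (fun i => lconst (lconst (a i)) * F ^ i).
Definition subst2 (h : {laurent {laurent k}}) F G : {laurent {laurent k}} :=
  lsum (fun j => subst1 (h j) F * G ^ j).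

(* A formal 2-form h du /\ dv is represented by its coefficient h. *)
Definition change_var F G (h : {laurent {laurent k}}) :=
  subst2 h F G * jacobian F G.

Definition res2 (h : {laurent {laurent k}}) : k := h (-1) (-1).

End TwoVariables.

(* Main.v *)
(* The map [h |-> h(f, g)] is continuous and the residue only sees finitely many
   terms, so one may take [h = u^i v^j] and compute the residue of
   [f^i g^j df /\ dg].  For [j >= 0] there is no pole in [y]; for [j = -1] only
   leading terms in [y] matter and one is left with [f0^i df0], [f0 = f(x, 0)].
   For [j <= -2] put [S = 1/g]; the form is [- f^i S^n df /\ dS] with [n >= 0],
   and [T^i S^n dT /\ dS] has residue zero for all [T], [S] and [i, n >= 0].
   In characteristic zero this form is exact; in general, induction on [i + n]
   shows that the residue is additive in [S] and in [T], which reduces the claim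
   to [S] and [T] monomials in [y].  The exponent [i <= -2] reduces to
   [i >= 0] by passing to [1/f], and [i = -1] by splitting [dlog f] as
   [dlog f0 + dlog (1 + T)] and expanding [1/(1 + T)]. *)
Require Import Defs.
From mathcomp Require Import all_boot all_order all_algebra ring zify.
From mathcomp Require Import boolp classical_sets fsbigop.
Import Order.TTheory GRing.Theory Num.Theory.
Set Implicit Arguments.
Unset Strict Implicit.
Unset Printing Implicit Defensive.
Local Open Scope ring_scope.

(** * Powers and derivations in a commutative ring *)

Section Polarization.
Variables (A : comNzRingType) (D : A -> A).
Hypothesis DD : forall a b, D (a + b) = D a + D b.
Hypothesis DM : forall a b, D (a * b) = D a * b + a * D b.

Lemma derivation0 : D 0 = 0.
Proof. by apply: (addrI (D 0)); rewrite -DD !addr0. Qed.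

Lemma derivation1 : D 1 = 0.
Proof. by apply: (addrI (D 1)); rewrite addr0 -{3}(mulr1 1) DM mulr1 mul1r. Qed.

Lemma derivationX a n : D (a ^+ n.+1) = a ^+ n * D a *+ n.+1.
Proof.
elim: n => [|n IHn]; first by rewrite expr0 mul1r.
by rewrite exprS DM IHn (mulrS _ n.+1) mulrnAr mulrA -exprS [D a * _]mulrC.
Qed.

(** Formally [D (U^d) / d] for [U = S^p T^q], with the division by [d] already carried out, hence
    valid in every characteristic. *)
Lemma expr_derivation_monomial S T d p q : (0 < d)%N -> (0 < p)%N -> (0 < q)%N ->
  (S ^+ p * T ^+ q) ^+ d.-1 * D (S ^+ p * T ^+ q) =
  S ^+ (d * p).-1 * T ^+ (d * q).-1 * (D S * T *+ p + S * D T *+ q).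
Proof.
case: d p q => [|d] [|p] [|q]// _ _ _; rewrite [d.+1.-1]/=.
rewrite DM !derivationX exprMn -!exprM.
have -> : ((d.+1 * p.+1).-1 = p.+1 * d + p)%N by lia.
have -> : ((d.+1 * q.+1).-1 = q.+1 * d + q)%N by lia.
by rewrite !exprD (exprS S p) (exprS T q); ring.
Qed.

(* Grouping the terms of the expansion of [(S + T)^n D (S + T)] by bidegree
   [(p, q)], each group is an integer multiple of [U^(d-1) D U], where
   [U = S^(p/d) T^(q/d)] and [d = gcd(p, q)]: no division is needed. *)
Lemma expr_derivationD (N : A -> Prop) n S T :
  N 0 -> (forall a b, N a -> N b -> N (a + b)) ->
  (forall m U, (m < n)%N -> N (U ^+ m * D U)) ->
  N (S ^+ n * D S) -> N (T ^+ n * D T) -> N ((S + T) ^+ n * D (S + T)).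
Proof.
move=> N0 ND Nlt NS NT.
have Nn a m : N a -> N (a *+ m).
  by move=> Na; elim: m => [|m IHm] //; rewrite mulrS; apply: ND.
rewrite DD mulrDr exprDn {1}big_ord_recl big_ord_recr /=.
rewrite subn0 subnn expr0 mulr1 mul1r bin0 binn !mulr1n.
set X := \sum_(i < n) _; set Y := \sum_(i < n) _.
have -> : (S ^+ n + X) * D S + (Y + T ^+ n) * D T =
    S ^+ n * D S + T ^+ n * D T + (X * D S + Y * D T) by ring.
apply: (ND); first exact: ND.
rewrite !mulr_suml -big_split; apply: big_ind => // -[k kn] _ /=.
rewrite /bump /= add1n.
pose p := (n - k)%N; pose q := k.+1; pose d := gcdn p q.
have d0 : (0 < d)%N by rewrite gcdn_gt0 orbT.
have dp : (d %| p)%N by rewrite dvdn_gcdl.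
have dq : (d %| q)%N by rewrite dvdn_gcdr.
have pE : (d * (p %/ d) = p)%N by rewrite mulnC divnK.
have qE : (d * (q %/ d) = q)%N by rewrite mulnC divnK.
have p'0 : (0 < p %/ d)%N by rewrite divn_gt0// dvdn_leq// /p; lia.
have q'0 : (0 < q %/ d)%N by rewrite divn_gt0// dvdn_leq.
have cop : coprime (p %/ d) (q %/ d).
  by rewrite /coprime -(eqn_pmul2l d0) muln_gcdr pE qE muln1.
have binE : ((q %/ d) * 'C(n, k.+1) = (p %/ d) * 'C(n, k))%N.
  by apply/eqP; rewrite -(eqn_pmul2l d0) !mulnA pE qE mul_bin_left.
(* Coprimality and [binE] make [p/d] divide [C(n,k+1)]; the quotient [c] is the integer multiple,
   and [C(n,k) = c (q/d)] as well. *)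
have /dvdnP[c cE] : (p %/ d %| 'C(n, k.+1))%N.
  by rewrite -(Gauss_dvdr _ cop) binE dvdn_mulr.
have cE' : 'C(n, k) = (c * (q %/ d))%N.
  by apply/eqP; rewrite -(eqn_pmul2l p'0) -binE cE; apply/eqP; lia.
suff -> : S ^+ (n - k.+1) * T ^+ k.+1 *+ 'C(n, k.+1) * D S +
     S ^+ (n - k) * T ^+ k *+ 'C(n, k) * D T =
     ((S ^+ (p %/ d) * T ^+ (q %/ d)) ^+ d.-1
        * D (S ^+ (p %/ d) * T ^+ (q %/ d))) *+ c.
  apply: Nn; apply: Nlt; have := gcdn_gt0 p q; have := dvdn_leq (ltn0Sn k) dq.
  by rewrite -/d; lia.
rewrite expr_derivation_monomial// pE qE cE cE' /p /q /=.
have -> : ((n - k).-1 = n - k.+1)%N by lia.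
have -> : (n - k = (n - k.+1).+1)%N by lia.
by rewrite !exprS; ring.
Qed.

End Polarization.

(** * Laurent series in one variable: orders, derivative, residue *)

Section OneVariable.
Variable R : comNzRingType.
Implicit Types a b : {laurent R}.

Lemma lcoef_sum (I : Type) (r : seq I) (P : pred I) (F : I -> {laurent R}) n :
  (\sum_(i <- r | P i) F i) n = \sum_(i <- r | P i) F i n.
Proof. by apply: (big_morph (fun a : {laurent R} => a n)). Qed.

Lemma lcoefMn a m n : (a *+ m) n = a n *+ m.
Proof. by elim: m => [|m IHm] //; rewrite !mulrS lcoefD IHm. Qed.

Lemma lcoefMz a (z : int) n : (a *~ z) n = a n *~ z.
Proof. by case: z => m /=; rewrite ?NegzE ?mulrNz ?lcoefN -?pmulrn lcoefMn. Qed.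

Lemma tpow_seriesW (m n : int) a : m <= n -> tpow_series n a -> tpow_series m a.
Proof. by move=> mn an i im; apply: an; lia. Qed.

Lemma tpow_seriesD n a b :
  tpow_series n a -> tpow_series n b -> tpow_series n (a + b).
Proof. by move=> an bn i /[dup] /an ai /bn bi; rewrite lcoefD ai bi addr0. Qed.

Lemma tpow_seriesN n a : tpow_series n a -> tpow_series n (- a).
Proof. by move=> an i /an ai; rewrite lcoefN ai oppr0. Qed.

Lemma tpow_series0 n : tpow_series n (0 : {laurent R}).
Proof. by []. Qed.

Lemma tpow_series_sum n (I : Type) (r : seq I) (P : pred I) (F : I -> {laurent R}) :
  (forall i, P i -> tpow_series n (F i)) ->
  tpow_series n (\sum_(i <- r | P i) F i).
Proof.
by move=> Fn; apply: big_ind; [exact: tpow_series0|exact: tpow_seriesD|].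
Qed.

Lemma tpow_series_ex a : exists n : int, tpow_series n a.
Proof. exact: lcoefP. Qed.

Lemma tpow_seriesM n m a b :
  tpow_series n a -> tpow_series m b -> tpow_series (n + m) (a * b).
Proof.
move=> an bm i inm; rewrite lcoefM; apply: fsbig1 => j _.
by have [/an->|nj] := ltP j n; [rewrite mul0r|rewrite bm ?mulr0//; lia].
Qed.

Lemma lcoefM_lead n m a b : tpow_series n a -> tpow_series m b ->
  (a * b) (n + m) = a n * b m.
Proof.
move=> an bm; rewrite lcoefM (@fsbigE _ _ _ _ _ [:: n])//; last first.
  move=> j _; rewrite inE => /negPf jn.
  have [/an->|nj] := ltP j n; first by rewrite mul0r.
  by rewrite bm ?mulr0//; lia.
by rewrite big_cons big_nil in_setT /= addr0; congr (_ * b _); lia.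
Qed.

Lemma tpow_series1 : tpow_series 0 (1 : {laurent R}).
Proof. by move=> i i0; rewrite lcoef1 ifF//; lia. Qed.

Lemma tpow_seriesX (n : int) a m :
  tpow_series n a -> tpow_series (n * m%:Z) (a ^+ m).
Proof.
move=> an; elim: m => [|m IHm]; first by rewrite mulr0 expr0; exact: tpow_series1.
rewrite exprS; have -> : n * m.+1%:Z = n + n * m%:Z by lia.
exact: tpow_seriesM.
Qed.

Lemma lcoefX_lead (n : int) a m :
  tpow_series n a -> (a ^+ m) (n * m%:Z) = a n ^+ m.
Proof.
move=> an; elim: m => [|m IHm]; first by rewrite mulr0 !expr0 lcoef1.
rewrite !exprS; have -> : n * m.+1%:Z = n + n * m%:Z by lia.
by rewrite lcoefM_lead ?IHm//; exact: tpow_seriesX.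
Qed.

Lemma lmono_subproof (c : R) (n : int) :
  exists N : int, forall i, i < N -> (if i == n then c else 0) = 0.
Proof. by exists n => i /lt_eqF->. Qed.
Definition lmono c n : {laurent R} := Laurent (lmono_subproof c n).

Lemma lmonoM_coef c n a i : (lmono c n * a) i = c * a (i - n).
Proof.
rewrite lcoefM (@fsbigE _ _ _ _ _ [:: n])//; last first.
  by move=> j _; rewrite inE /= => /negPf->; rewrite mul0r.
by rewrite big_cons big_nil in_setT /= addr0 eqxx.
Qed.

Lemma lconst_mono c : lconst c = lmono c 0.
Proof. exact: laurentP. Qed.

Lemma lconst_coef c a i : (lconst c * a) i = c * a i.
Proof. by rewrite lconst_mono lmonoM_coef subr0. Qed.

Lemma lconst0 : lconst 0 = 0 :> {laurent R}.
Proof. by apply: laurentP => i /=; case: eqP. Qed.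

Lemma tpow_series_lconst (c : R) : tpow_series 0 (lconst c).
Proof. by move=> i /lt_eqF /= ->. Qed.

Lemma tpow_series_lmono (c : R) n : tpow_series n (lmono c n).
Proof. by move=> i /lt_eqF /= ->. Qed.

Lemma lmonoM c d n m : lmono c n * lmono d m = lmono (c * d) (n + m).
Proof.
apply: laurentP => i; rewrite lmonoM_coef /=.
have -> : (i - n == m) = (i == n + m) by lia.
by case: ifP => //; rewrite mulr0.
Qed.

Lemma lmonoX c n m : lmono c n ^+ m = lmono (c ^+ m) (n * m%:Z).
Proof.
elim: m => [|m IHm]; first by rewrite mulr0 !expr0 -lconst_mono.
by rewrite !exprS IHm lmonoM; congr lmono; lia.
Qed.

(** Subtracting the lowest monomial finitely often raises the order to [N], so closure under finite
    sums is enough and no limit enters. *)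
Lemma laurent_ind_mono (P : {laurent R} -> Prop) :
  (forall a b, P a -> P b -> P (a + b)) -> (forall c n, P (lmono c n)) ->
  (exists N : int, forall a, tpow_series N a -> P a) -> forall a, P a.
Proof.
move=> PD Pm [N PN] a.
suff H m b : tpow_series (N - m%:Z) b -> P b.
  by have [n an] := tpow_series_ex a; apply: (H `|N - n|%N); apply: tpow_seriesW an; lia.
elim: m b => [|m IHm] b; first by rewrite subr0; exact: PN.
move=> bm; rewrite -[b](subrK (lmono (b (N - m.+1%:Z)) (N - m.+1%:Z))).
apply: PD => //; apply: IHm => i iN; rewrite lcoefD lcoefN /=.
by case: eqP => [->|?]; [rewrite subrr|rewrite bm ?subr0//; lia].
Qed.

Lemma lderivD a b : lderiv (a + b) = lderiv a + lderiv b.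
Proof. by apply: laurentP => i; rewrite /= mulrzDl. Qed.

Lemma lderivM a b : lderiv (a * b) = lderiv a * b + a * lderiv b.
Proof.
apply: laurentP => n.
have [Na aN] := lcoef_bound a; have [Nb bN] := lcoef_bound b.
have -> : (lderiv a * b + a * lderiv b) n =
    lmul_coef (fun i => a i *~ i) b (n + 1) +
    lmul_coef a (fun i => b i *~ i) (n + 1).
  congr (_ + _); last first.
    rewrite lcoefM; apply: eq_fsbigr => i _ /=.
    by have -> : n - i + 1 = n + 1 - i by lia.
  rewrite lcoefM (reindex_fsbigT (fun i : int => i - 1)); last first.
    by exists (fun i : int => i + 1) => i; lia.
  apply: eq_fsbigr => i _ /=; rewrite subrK; congr (_ * b _); lia.
pose L := (`|n| + 2 + Na + Nb)%N; have nL : n + 1 + Na%:Z + Nb%:Z < L%:Z by lia.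
have aN' i : i < - Na%:Z -> a i *~ i = 0 by move=> /aN->; rewrite mul0rz.
have bN' i : i < - Nb%:Z -> b i *~ i = 0 by move=> /bN->; rewrite mul0rz.
rewrite /= !(lmul_coef_window (N := Na) (M := Nb) _ _ nL)//.
rewrite -big_split mulrz_suml; apply: eq_bigr => i _ /=.
by rewrite mulrzAl mulrzAr -mulrzDr; congr (_ *~ _); lia.
Qed.

Lemma lderiv0 : lderiv (0 : {laurent R}) = 0.
Proof. exact: (derivation0 lderivD). Qed.

Lemma tpow_series_lderiv n a : tpow_series n a -> tpow_series (n - 1) (lderiv a).
Proof. by move=> an i iN; rewrite /= an ?mul0rz//; lia. Qed.

(** The coefficient at [-1] carries the factor 0, so here, unlike in [tpow_series_lderiv], the order
    bound does not drop. *)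
Lemma tpow_series0_lderiv a : tpow_series 0 a -> tpow_series 0 (lderiv a).
Proof.
move=> a0 i i0 /=; have [->|?] := eqVneq (i + 1) 0; first by rewrite mulr0z.
by rewrite a0 ?mul0rz//; lia.
Qed.

Lemma lderiv_mono c n : lderiv (lmono c n) = lmono (c *~ n) (n - 1).
Proof.
apply: laurentP => i /=; have -> : (i == n - 1) = (i + 1 == n) by lia.
by case: eqP => [->|_] //; rewrite mul0rz.
Qed.

(** Where [n + 1] is invertible the form is exact; in general polarization and induction on [n]
    reduce to monomials. The ring is arbitrary because both [k] and [k((x))] serve as coefficients
    later. *)
Lemma res_expr_lderiv n a : (a ^+ n * lderiv a) (-1) = 0.
Proof.
elim/ltn_ind: n a => n IHn; apply: laurent_ind_mono.
- move=> a b; apply: (expr_derivationD lderivD lderivM (N := fun c => c (-1) = 0)) => //.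
  + by move=> {}a {}b a0 b0; rewrite lcoefD a0 b0 addr0.
  + by move=> m U /IHn.
- move=> c m; rewrite lmonoX lderiv_mono lmonoM /=; case: eqP => // E.
  (* The exponent is [-1] only if [m (n + 1) = 0], so [m = 0], and the derivative contributes the
     factor [m]. *)
  by have -> : m = 0; [nia|rewrite mulr0z mulr0].
- exists 0 => a a0.
  by have := tpow_seriesM (tpow_seriesX (m := n) a0) (tpow_series0_lderiv a0); apply; lia.
Qed.

End OneVariable.

(** Supplies the order beyond which a tail has no pole: since [l a >= -|l| a], the threshold
    [|l| a + 1] outweighs that term. *)
Lemma tail_bound (l : int) (a b : nat) :
  0 < (`|l| * a + 1)%N%:Z * b.+1%:Z + l * a%:Z.
Proof.
have lower : - (`|l| * a)%N%:Z <= l * a%:Z.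
  by rewrite PoszM -mulNr ler_wpM2r//; lia.
have := leq_pmulr (`|l| * a + 1) (ltn0Sn b); rewrite -PoszM.
move: (l * a%:Z) lower => y; move: (`|l| * a)%N => x.
by move: ((x + 1) * b.+1)%N => z; lia.
Qed.

(** Takes the common factor [r] out of the Jacobian of [t y^(-br)] and [s y^(ar)], leaving the
    bracket of [expr_derivation_monomial]. *)
Lemma bidegree_mulrz (A : comNzRingType) (x y t s t' s' : A) (a b : nat) (r : int) :
  x * (y * (t' * (s *~ (a%:Z * r)))) - x * (y * (t *~ (- (b%:Z * r)) * s')) =
  x * y * (t' * s *+ a + t * s' *+ b) *~ r.
Proof.
rewrite -[s *~ _]mulrzr -[t *~ _]mulrzr -[RHS]mulrzr !rmorphN !rmorphM /=.
by rewrite -!pmulrn; ring.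
Qed.

(** * Leading terms of inverses and integer powers *)

Section Valuation.
Variable F : fieldType.
Implicit Type a : {laurent F}.

Lemma laurent_valuation a :
  a != 0 -> exists2 n : int, tpow_series n a & a n != 0.
Proof.
move=> a0; apply: contrapT => no; move/eqP: a0; apply.
have [N aN] := tpow_series_ex a.
have H m : tpow_series (N + m%:Z) a.
  elim: m => [|m IHm]; first by rewrite addr0.
  move=> i iN; have [->|?] := eqVneq i (N + m%:Z); last by apply: IHm; lia.
  by apply/eqP; apply: contraT => ?; case: no; exists (N + m%:Z).
by apply: laurentP => i; apply: (H `|i - N|.+1%N); lia.
Qed.

Lemma laurentV_lead (n : int) a : tpow_series n a -> a n != 0 ->
  tpow_series (- n) a^-1 /\ a^-1 (- n) = (a n)^-1.
Proof.
move=> an an0.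
have a0 : a != 0 by apply: contraNneq an0 => ->.
have /laurent_valuation[m bm bm0] : a^-1 != 0 by rewrite invr_eq0.
have := lcoefM_lead an bm; rewrite divff// lcoef1.
case: eqP => [nm E|_ /esym/eqP]; last by rewrite mulf_eq0 (negPf an0) (negPf bm0).
have -> : - n = m by lia.
by split=> //; apply: (mulfI an0); rewrite -E divff.
Qed.

Lemma laurent_exprz_lead (n : int) a (i : int) : tpow_series n a -> a n != 0 ->
  tpow_series (n * i) (a ^ i) /\ (a ^ i) (n * i) = (a n) ^ i.
Proof.
move=> an an0; case: i => m.
  by rewrite -!exprnP; split; [exact: tpow_seriesX|exact: lcoefX_lead].
have [bn bE] := laurentV_lead an an0.
rewrite NegzE -!exprnN -!exprVn -bE.
have -> : n * - m.+1%:Z = - n * m.+1%:Z by lia.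
by split; [exact: tpow_seriesX|exact: lcoefX_lead].
Qed.

End Valuation.

(** * Logarithmic derivatives and negative powers *)

Section FieldDerivation.
Variables (F : fieldType) (D : F -> F).
Hypothesis DM : forall a b, D (a * b) = D a * b + a * D b.

Lemma derivation_dlogM a b : a != 0 -> b != 0 ->
  (a * b)^-1 * D (a * b) = a^-1 * D a + b^-1 * D b.
Proof. by move=> a0 b0; rewrite DM; field; rewrite a0 b0. Qed.

(** [Negz m.+1] is [-(m + 2)]: as [D (a^-1) = - a^-2 D a], exponents at most [-2] of [a] become
    exponents [m >= 0] of [a^-1]. *)
Lemma exprz_derivation_neg a (m : nat) :
  a != 0 -> a ^ Negz m.+1 * D a = - (a^-1 ^+ m * D a^-1).
Proof.
move=> a0; have /eqP := DM a a^-1.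
rewrite divff// (derivation1 DM) eq_sym addr_eq0 => /eqP DV.
rewrite NegzE -exprnN -exprVn !exprS.
have -> : D a = - (a * D a^-1) * a by rewrite -DV -mulrA mulVf ?mulr1.
by field.
Qed.

(** Expands [1 / (1 + a)] by one term with exact remainder, which avoids any infinite series. *)
Lemma geometric_step (a x : F) m : 1 + a != 0 ->
  (- a) ^+ m * ((1 + a)^-1 * x) =
  (- a) ^+ m * x + (- a) ^+ m.+1 * ((1 + a)^-1 * x).
Proof. by move=> a0; rewrite exprS; field. Qed.

End FieldDerivation.

(** * Jacobians and the vanishing residues of [T^i S^n dT /\ dS] *)

Section TwoVariables.
Variable k : fieldType.
Implicit Types F G S T : {laurent {laurent k}}.

Lemma dxD F G : dx (F + G) = dx F + dx G.
Proof. by apply: laurentP => j; exact: lderivD. Qed.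

Lemma dxM F G : dx (F * G) = dx F * G + F * dx G.
Proof.
apply: laurentP => j.
have [N FN] := lcoef_bound F; have [M GM] := lcoef_bound G.
have FN' i : i < - N%:Z -> dx F i = 0 by move=> /FN /= ->; rewrite lderiv0.
have GM' i : i < - M%:Z -> dx G i = 0 by move=> /GM /= ->; rewrite lderiv0.
pose L := (`|j| + N + M).+1; have jL : j + N%:Z + M%:Z < L%:Z by lia.
have -> : dx (F * G) j = lderiv ((F * G) j) by [].
rewrite lcoefD [(F * G) j](lmul_coef_window FN GM jL).
rewrite [(dx F * G) j](lmul_coef_window FN' GM jL).
rewrite [(F * dx G) j](lmul_coef_window FN GM' jL) -big_split /=.
rewrite (big_morph _ (@lderivD k) (@lderiv0 k)).
by apply: eq_bigr => i _; rewrite lderivM.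
Qed.

(** In each argument the Jacobian is a derivation, so the lemmas on derivations apply with the other
    argument fixed. *)
Lemma jacobianDl G F F' : jacobian (F + F') G = jacobian F G + jacobian F' G.
Proof. by rewrite /jacobian /dy dxD lderivD; ring. Qed.

Lemma jacobianMl G F F' :
  jacobian (F * F') G = jacobian F G * F' + F * jacobian F' G.
Proof. by rewrite /jacobian /dy dxM lderivM; ring. Qed.

Lemma jacobianDr F G G' : jacobian F (G + G') = jacobian F G + jacobian F G'.
Proof. by rewrite /jacobian /dy dxD lderivD; ring. Qed.

Lemma jacobianMr F G G' :
  jacobian F (G * G') = jacobian F G * G' + G * jacobian F G'.
Proof. by rewrite /jacobian /dy dxM lderivM; ring. Qed.

Lemma tpow_series_dx n F : tpow_series n F -> tpow_series n (dx F).
Proof. by move=> Fn i /Fn /= ->; rewrite lderiv0. Qed.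

Lemma tpow_series_jacobian n m F G : tpow_series n F -> tpow_series m G ->
  tpow_series (n + m - 1) (jacobian F G).
Proof.
move=> Fn Gm; apply: tpow_seriesD.
  rewrite -addrA; exact: tpow_seriesM (tpow_series_dx Fn) (tpow_series_lderiv Gm).
rewrite addrAC; apply: tpow_seriesN.
exact: tpow_seriesM (tpow_series_lderiv Fn) (tpow_series_dx Gm).
Qed.

Lemma tpow_series0_jacobian F G :
  tpow_series 0 F -> tpow_series 0 G -> tpow_series 0 (jacobian F G).
Proof.
move=> F0 G0; rewrite -[0]addr0; apply: tpow_seriesD.
  exact: tpow_seriesM (tpow_series_dx F0) (tpow_series0_lderiv G0).
apply: tpow_seriesN.
exact: tpow_seriesM (tpow_series0_lderiv F0) (tpow_series_dx G0).
Qed.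

Lemma res2D F G : res2 (F + G) = res2 F + res2 G.
Proof. by []. Qed.

Lemma res2N F : res2 (- F) = - res2 F.
Proof. by []. Qed.

Lemma res2_tpow_series F : tpow_series 0 F -> res2 F = 0.
Proof. by rewrite /res2 => ->. Qed.

Lemma dx_mono (s : {laurent k}) n : dx (lmono s n) = lmono (lderiv s) n.
Proof. by apply: laurentP => j /=; case: eqP => // _; rewrite lderiv0. Qed.

(** The [y]-order is at least [m (i + 1) + p (n + 1) - 1], hence nonnegative. *)
Lemma res2_expr_jacobian_tail i n (m p : int) T S :
  tpow_series m T -> tpow_series p S -> 0 < m * i.+1%:Z + p * n.+1%:Z ->
  res2 (T ^+ i * (S ^+ n * jacobian T S)) = 0.
Proof.
move=> Tm Sp mp; apply: res2_tpow_series; apply: tpow_seriesW; last first.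
  exact: tpow_seriesM (tpow_seriesX Tm)
    (tpow_seriesM (tpow_seriesX Sp) (tpow_series_jacobian Tm Sp)).
lia.
Qed.

(** A term in [y^-1] requires [j (i + 1) + l (n + 1) = 0]. With [i + 1 = d a], [n + 1 = d b] and
    [a], [b] coprime, this forces [l = a r], [j = - b r]. The coefficient of [y^-1] is then [r]
    times [U^(d-1) dU] with [U = t^a s^b], which has no residue in [x]. *)
Lemma res2_expr_jacobian_mono i n (t s : {laurent k}) (j l : int) :
  res2 (lmono t j ^+ i * (lmono s l ^+ n * jacobian (lmono t j) (lmono s l))) = 0.
Proof.
rewrite /jacobian /dy !dx_mono !lderiv_mono !lmonoX !lmonoM !mulrBr !lmonoM.
rewrite res2D res2N /res2 /=.
have -> : (-1 == j * i%:Z + (l * n%:Z + (j + (l - 1)))) =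
    (j * i.+1%:Z + l * n.+1%:Z == 0) by lia.
have -> : (-1 == j * i%:Z + (l * n%:Z + (j - 1 + l))) =
    (j * i.+1%:Z + l * n.+1%:Z == 0) by lia.
case: eqP => [E|_]; last by rewrite subrr.
pose d := gcdn i.+1 n.+1; have d0 : (0 < d)%N by rewrite gcdn_gt0.
have [a aE] := dvdnP (dvdn_gcdl i.+1 n.+1).
have [b bE] := dvdnP (dvdn_gcdr i.+1 n.+1).
rewrite -/d in aE bE.
have a0 : (0 < a)%N by lia.
have b0 : (0 < b)%N by lia.
have cop : coprime a b.
  by rewrite /coprime -(eqn_pmul2r d0) muln_gcdl -aE -bE mul1n.
have ab : j * a%:Z + l * b%:Z = 0.
  have dZ : d%:Z != 0 by lia.
  by apply: (mulIf dZ); rewrite mul0r mulrDl -!mulrA -!PoszM -aE -bE.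
have [r lE] : exists r : int, l = a%:Z * r.
  have : (a%:Z %| l)%Z.
    rewrite -(Gauss_dvdzl l (p := b%:Z))//.
    by apply/dvdzP; exists (- j); lia.
  by case/dvdzP => r ->; exists r; rewrite mulrC.
have jE : j = - (b%:Z * r).
  have aZ : a%:Z != 0 by lia.
  apply: (mulIf aZ); lia.
rewrite lE jE.
transitivity (((t ^+ i * s ^+ n * (lderiv t * s *+ a + t * lderiv s *+ b)) *~ r) (-1)).
  rewrite -lcoefN -lcoefD; congr (lcoef _ _).
  exact: bidegree_mulrz.
rewrite lcoefMz.
have -> : i = (d * a).-1 by lia.
have -> : n = (d * b).-1 by lia.
rewrite -(expr_derivation_monomial (@lderivM k))//.
by rewrite res_expr_lderiv mul0rz.
Qed.

(** Polarization in [S] calls for smaller [n] with the same [T]; once [S] is a monomial,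
    polarization in [T] calls for smaller [i]. New elements [U] appear, so the induction on [i + n]
    ranges over all [T] and [S]. *)
Lemma res2_expr_jacobian i n T S :
  res2 (T ^+ i * (S ^+ n * jacobian T S)) = 0.
Proof.
have [m] := ubnP (i + n); elim: m => // m IHm in i n T S *.
rewrite ltnS => inm.
have res2_add (c a b : {laurent {laurent k}}) :
    res2 (c * a) = 0 -> res2 (c * b) = 0 -> res2 (c * (a + b)) = 0.
  by move=> ca cb; rewrite mulrDr res2D ca cb addr0.
elim/laurent_ind_mono: S => [S S' QS QS'|s l|].
- apply: (expr_derivationD (jacobianDr T) (jacobianMr T)
    (N := fun c => res2 (T ^+ i * c) = 0)) => //.
  + by rewrite mulr0.
  + exact: res2_add.
  + by move=> n' U n'n; apply: IHm; lia.
- rewrite mulrCA; elim/laurent_ind_mono: T => [T T' QT QT'|t j|].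
  + apply: (expr_derivationD (jacobianDl _) (jacobianMl _)
      (N := fun c => res2 (lmono s l ^+ n * c) = 0)) => //.
    * by rewrite mulr0.
    * exact: res2_add.
    * by move=> i' U i'i; rewrite mulrCA; apply: IHm; lia.
  + by rewrite mulrCA; exact: res2_expr_jacobian_mono.
  + exists (`|l| * n.+1 + 1)%N%:Z => T Tm; rewrite mulrCA.
    by apply: (res2_expr_jacobian_tail Tm (@tpow_series_lmono _ s l)); exact: tail_bound.
(* [T] is fixed here, so its order [p] may enter the bound on the tail of [S]. *)
- have [p Tp] := tpow_series_ex T; exists (`|p| * i.+1 + 1)%N%:Z => S Sm.
  by apply: (res2_expr_jacobian_tail Tp Sm); rewrite addrC; exact: tail_bound.
Qed.

Lemma jacobian_lconst (a : {laurent k}) G :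
  jacobian (lconst a) G = lconst (lderiv a) * dy G.
Proof.
rewrite /jacobian lconst_mono dx_mono -lconst_mono /dy lderiv_mono mulr0z.
have -> : lmono 0 (0 - 1) = 0 :> {laurent {laurent k}}.
  by apply: laurentP => j /=; case: eqP.
by rewrite mul0r subr0.
Qed.

Lemma res2_dlog_jacobian n f S : tpow_series 0 f -> f 0 != 0 ->
  res2 (f^-1 * (S ^+ n * jacobian f S)) = 0.
Proof.
(* Thus [f = c (1 + T)] with [c] constant in [y] and [T] divisible by [y]. *)
move=> f_0 f00; pose c := lconst (f 0); pose T := c^-1 * f - 1.
have c0 : c != 0.
  by apply: contraNneq f00 => /(congr1 (fun F : {laurent {laurent k}} => F 0)) /= ->.
have cV : c^-1 = lconst (f 0)^-1.
  apply: (mulfI c0); rewrite divff//; apply: laurentP => j.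
  by rewrite lconst_coef lcoef1 /=; case: eqP => _; rewrite ?divff ?mulr0.
have T1 : tpow_series 1 T.
  move=> j j1; rewrite lcoefD lcoefN cV lconst_coef lcoef1.
  case: eqP => [->|?]; first by rewrite mulVf ?subrr.
  by rewrite (f_0 j) ?mulr0 ?subr0//; lia.
have fE : f = c * (1 + T) by rewrite /T addrC subrK mulrA divff ?mul1r.
have T0 : 1 + T != 0.
  by apply: contraNneq f00 => T0; rewrite fE T0 mulr0.
set X := S ^+ n * jacobian T S.
have -> : f^-1 * (S ^+ n * jacobian f S) =
    lconst ((f 0)^-1 * lderiv (f 0)) * (S ^+ n * dy S) + (1 + T)^-1 * X.
  rewrite mulrCA {2}fE {1}fE.
  rewrite (derivation_dlogM (D := fun F => jacobian F S) (jacobianMl S))//.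
  have -> : lconst ((f 0)^-1 * lderiv (f 0)) = c^-1 * lconst (lderiv (f 0)).
    by rewrite cV !lconst_mono lmonoM.
  rewrite jacobian_lconst jacobianDl.
  rewrite (derivation1 (D := fun F => jacobian F S) (jacobianMl S)) add0r mulrDr.
  have rearrange (A : comNzRingType) (a b d e u v : A) :
    a * (b * (d * e)) + a * (u * v) = b * d * (a * e) + u * (a * v) by ring.
  exact: rearrange.
(* The [dlog c] part is a factor constant in [y] times [S^n dS/dy], which has no [y^-1] term by
   [res_expr_lderiv] over [k((x))]. *)
have drop F :
    res2 (lconst ((f 0)^-1 * lderiv (f 0)) * (S ^+ n * dy S) + F) = res2 F.
  by rewrite res2D /res2 lconst_coef res_expr_lderiv mulr0 add0r.
rewrite drop; have geom m : res2 ((1 + T)^-1 * X) = res2 ((- T) ^+ m * ((1 + T)^-1 * X)).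
  elim: m => [|m ->]; first by rewrite expr0 mul1r.
  rewrite geometric_step//.
  rewrite res2D exprNn -signr_odd.
  have -> : res2 ((-1) ^+ odd m * T ^+ m * X) = 0; last by rewrite add0r.
  by case: (odd m); rewrite ?expr1 ?expr0 ?mulN1r ?mul1r ?mulNr ?res2N
    res2_expr_jacobian ?oppr0.
(* Each factor [T] raises the [y]-order by at least 1, so [|p|] of them remove the pole of the
   remainder. *)
have [p Xp] := tpow_series_ex ((1 + T)^-1 * X).
rewrite (geom `|p|%N); apply: res2_tpow_series.
apply: tpow_seriesW (tpow_seriesM (tpow_seriesX (tpow_seriesN T1)) Xp); lia.
Qed.

Lemma res2_exprz_jacobian (i : int) n f S : tpow_series 0 f -> f 0 != 0 ->
  res2 (f ^ i * (S ^+ n * jacobian f S)) = 0.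
Proof.
move=> f_0 f00; case: i => [m|[|m]].
- by rewrite -exprnP res2_expr_jacobian.
- exact: res2_dlog_jacobian.
have f0 : f != 0 by apply: contraNneq f00 => ->.
rewrite mulrCA (exprz_derivation_neg (D := fun F => jacobian F S) (jacobianMl S))//.
by rewrite mulrN res2N mulrCA res2_expr_jacobian oppr0.
Qed.

(** Invariance of the residue in one variable, [a] being a uniformizer; for [i = -1] the leading
    terms give [(a 1)^-1 (a 1) = 1]. *)
Lemma res_exprz_lderiv (a : {laurent k}) (i : int) :
  tpow_series 1 a -> a 1 != 0 -> (a ^ i * lderiv a) (-1) = (i == -1)%:R.
Proof.
move=> a1 a10; case: i => [m|[|m]].
- by rewrite -exprnP res_expr_lderiv.
- have [bn bE] := laurentV_lead a1 a10.
  rewrite NegzE -exprnN expr1.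
  have := lcoefM_lead bn (tpow_series_lderiv a1).
  by rewrite subrr addr0 bE /= add0r mulr1z mulVf// => ->.
have a0 : a != 0 by apply: contraNneq a10 => ->.
rewrite (exprz_derivation_neg (@lderivM k))//.
by rewrite lcoefN res_expr_lderiv oppr0.
Qed.

End TwoVariables.

(** * Monomial forms, completeness and residues of series *)

Section Convergence.
Variable k : fieldType.
Implicit Types F G : {laurent {laurent k}}.

(** This is the theorem for [h = u^i v^j]. *)
Lemma res2_monomial_jacobian (f g : {laurent {laurent k}}) (i j : int) :
  tpow_series 0 f -> tpow_series 1 (f 0) -> f 0 1 != 0 ->
  tpow_series 1 g -> g 1 != 0 ->
  res2 (f ^ i * (g ^ j * jacobian f g)) = ((i == -1) && (j == -1))%:R.
Proof.
move=> f_0 f01 f01_neq0 g1 g1_neq0.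
have f00 : f 0 != 0 by apply: contraNneq f01_neq0 => ->.
have [fi fiE] := laurent_exprz_lead i f_0 f00; rewrite mul0r in fi fiE.
case: j => [m|[|m]].
- rewrite andbF -exprnP; apply: res2_tpow_series.
  rewrite -[0]addr0; apply: tpow_seriesM => //; rewrite -[0]addr0.
  apply: tpow_seriesM; last by apply: tpow_series0_jacobian => //; apply: tpow_seriesW g1.
  by apply: tpow_seriesW (tpow_seriesX g1); lia.
- have [gV gVE] := laurentV_lead g1 g1_neq0.
  have rearrange (A : comNzRingType) (a b c d e u : A) :
    a * (b * (c * d - e * u)) = (a * c) * (b * d) - (a * e) * (b * u) by ring.
  rewrite andbT /jacobian rearrange res2D res2N.
  have -> : res2 (f ^ i * dy f * (g^-1 * dx g)) = 0.
    apply: res2_tpow_series.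
    apply: (tpow_seriesM (tpow_seriesM fi (tpow_series0_lderiv f_0))
                         (tpow_seriesM gV (tpow_series_dx g1))).
  rewrite oppr0 addr0 -(res_exprz_lderiv i f01 f01_neq0) /res2.
  (* The leading term of [g^-1 dy g] is [y^-1] with coefficient 1, so the residue of [f0^i df0] is
     left. *)
  have := lcoefM_lead (tpow_seriesM fi (tpow_series_dx f_0))
                      (tpow_seriesM gV (tpow_series_lderiv g1)).
  rewrite (lcoefM_lead fi (tpow_series_dx f_0)).
  rewrite (lcoefM_lead gV (tpow_series_lderiv g1)) fiE gVE => /= ->.
  by rewrite subrr add0r mulr1z mulVf ?mulr1.
- have g0 : g != 0 by apply: contraNneq g1_neq0 => ->.
  rewrite (exprz_derivation_neg (D := jacobian f) (jacobianMr f))//.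
  by rewrite mulrN res2N res2_exprz_jacobian// oppr0 andbF.
Qed.

Lemma tpow_series_coefM n F G (m : int) :
  (forall b : int, tpow_series n (F b * G (m - b))) -> tpow_series n ((F * G) m).
Proof.
move=> FG; have [N FN] := lcoef_bound F; have [M GM] := lcoef_bound G.
pose L := (`|m| + N + M).+1; have mL : m + N%:Z + M%:Z < L%:Z by lia.
rewrite [(F * G) m](lmul_coef_window FN GM mL).
by apply: tpow_series_sum => b _; exact: FG.
Qed.

(* For [j <= J] the coefficient [f_j] of [y^j] has a pole of order at most
   [M j - 1]; this weight is additive, so it controls all powers of [f]. *)
Lemma tpow_series_exp_coef (f : {laurent {laurent k}}) (j : int) :
  tpow_series 0 f -> tpow_series 1 (f 0) ->
  exists B : int, forall i : nat, tpow_series (i%:Z - B) ((f ^+ i) j).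
Proof.
move=> f_0 f01.
have [j0|j0] := ltP j 0.
  exists 0 => i; have /(_ j) -> := tpow_seriesX (m := i) f_0; last by rewrite mul0r.
  exact: tpow_series0.
have /choice[m mP] b : exists m : nat, tpow_series (- m%:Z) (f b).
  exact: lcoef_bound.
(* The added 1 gives [m b + 1 <= M b] for [1 <= b <= j]; at [b = 0] the bound asks for order 1, the
   hypothesis on [f 0]. *)
pose M := (\sum_(b < `|j|.+1) m (b : nat)%:Z + 1)%N.
have fM (b : int) : b <= j -> tpow_series (1 - M%:Z * b) (f b).
  move=> bj; have [b0|b0|->] := ltgtP b 0.
  - by rewrite f_0//; exact: tpow_series0.
  - apply: tpow_seriesW (mP b); have bJ : (`|b| < `|j|.+1)%N by lia.
    have : (m b + 1 <= M)%N.
      by rewrite leq_add2r (bigD1 (Ordinal bJ))//= gez0_abs ?leq_addr// ltW.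
    by move: (m b) M => x y xy; nia.
  - by rewrite mulr0 subr0.
suff H i a : a <= j -> tpow_series (i%:Z - M%:Z * a) ((f ^+ i) a).
  by exists (M%:Z * j) => i; exact: H.
elim: i a => [|i IHi] a aj.
  rewrite expr0; have [->|a0] := eqVneq a 0; last first.
    by rewrite lcoef1 (negPf a0); exact: tpow_series0.
  by rewrite mulr0 subrr; exact: tpow_series1.
rewrite exprS; apply: tpow_series_coefM => b.
have [b0|b0] := ltP b 0; first by rewrite f_0// mul0r; exact: tpow_series0.
have [ab|ab] := ltP a b.
  have /(_ (a - b)) -> := tpow_seriesX (m := i) f_0; last by rewrite mul0r subr_lt0.
  by rewrite mulr0; exact: tpow_series0.
have -> : i.+1%:Z - M%:Z * a = (1 - M%:Z * b) + (i%:Z - M%:Z * (a - b)) by lia.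
by apply: tpow_seriesM; [apply: fM|apply: IHi]; lia.
Qed.

Lemma seq_cvg_complete (l : int) (S : nat -> {laurent {laurent k}}) :
  (forall n, tpow_series l (S n)) ->
  (forall j N : int, exists p, forall n, (p <= n)%N ->
    tpow_series N (S n j - S p j)) ->
  exists2 F, tpow_series l F & seq_cvg S F.
Proof.
move=> Sl SC.
have /choice[c cP] (jN : int * int) : exists p, forall n, (p <= n)%N ->
  tpow_series jN.2 (S n jN.1 - S p jN.1) by exact: SC.
have cE j N n (i : int) : (c (j, N) <= n)%N -> i < N -> S n j i = S (c (j, N)) j i.
  by move=> cn iN; apply/eqP; rewrite -subr_eq0; apply/eqP; exact: (cP (j, N)).
(* From stage [c (j, i + 1)] on, the coefficients of index below [i + 1], among them that at [i], no
   longer change. *)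
pose Fc (j i : int) := S (c (j, i + 1)) j i.
have FcE j i n : (c (j, (i + 1)%R) <= n)%N -> S n j i = Fc j i.
  by move=> cn; apply: cE => //; lia.
(* All negative indices are settled at stage [c (j, 0)], so the limit inherits the pole bound of
   that stage. *)
have FcB j : exists N : int, forall i, i < N -> Fc j i = 0.
  have [B BP] := lcoef_bound (S (c (j, 0)) j); exists (- B%:Z) => i iB.
  rewrite -(FcE j i _ (leq_maxl _ (c (j, 0)))).
  by rewrite (cE j 0) ?leq_maxr ?BP//; lia.
have FB : exists N : int, forall j, j < N -> Laurent (FcB j) = 0.
  by exists l => j jl; apply: laurentP => i /=; rewrite /Fc Sl.
exists (Laurent FB) => [j jl|].
  by apply: laurentP => i /=; rewrite /Fc Sl.
split.
  exists l => n; apply: tpow_seriesD => //; apply: tpow_seriesN => j jl.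
  by apply: laurentP => i /=; rewrite /Fc Sl.
move=> j N; exists (c (j, N)) => // n /= cn i iN; rewrite lcoefD lcoefN /=.
rewrite -(FcE j i _ (leq_maxl _ (c (j, N)))).
by rewrite !(cE j N _ i) ?leq_maxr ?subrr.
Qed.

(** The [y^-1] coefficient of the product involves finitely many [S n a], and each is eventually
    divisible by a power of [x] cancelling the pole of its partner in [G]. *)
Lemma res2_seq_to0 (S : nat -> {laurent {laurent k}}) G : seq_to0 S ->
  exists p, forall n, (p <= n)%N -> res2 (S n * G) = 0.
Proof.
move=> [[l Sl] S0]; have [M GM] := lcoef_bound G.
pose N := `|l|%N; have SN n (i : int) : i < - N%:Z -> S n i = 0.
  by move=> iN; apply: Sl; lia.
pose L := (2 + N + M)%N; have mL : -1 + N%:Z + M%:Z < L%:Z by lia.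
have /choice[c cP] (a : int) : exists p, forall n, (p <= n)%N ->
    tpow_series 0 (S n a * G (-1 - a)).
  have [B GB] := tpow_series_ex (G (-1 - a)).
  have [p _ pP] := S0 a (- B); exists p => n pn.
  by rewrite -(addNr B); apply: tpow_seriesM => //; exact: pP.
exists (\max_(a <- window N L) c a)%N => n cn.
rewrite /res2 [(S n * G) (-1)](lmul_coef_window (SN n) GM mL) lcoef_sum.
rewrite big_seq big1// => a aw; apply: cP => //.
by apply: leq_trans cn; exact: leq_bigmax_seq.
Qed.

Section LaurentSum.
Variables (l : int) (t : int -> {laurent {laurent k}}).
Hypothesis tl : forall i, tpow_series l (t i).
Hypothesis t_cvg : forall j N : int, exists p : nat, forall i : int,
  p%:Z <= i -> tpow_series N (t i j).
Hypothesis t_low : exists q : nat, forall i : int, i < - q%:Z -> t i = 0.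

(** The partial sums are Cauchy coefficientwise, so [lsum] is a genuine limit and not merely its
    default value 0. *)
Lemma lsum_cvg : tpow_series l (lsum t) /\
  seq_cvg (fun n => \sum_(i < n.*2) t (i%:Z - n%:Z)) (lsum t).
Proof.
pose S n := \sum_(i < n.*2) t (i%:Z - n%:Z).
(* The windows [[-n, n)] grow at both ends; for large [n] the new lower term vanishes by [t_low]. *)
have SS n : S n.+1 = t (- n.+1%:Z) + S n + t n%:Z.
  rewrite /S doubleS big_ord_recl big_ord_recr /= addrA add0r.
  congr (_ + _ + t _); last by rewrite /bump; lia.
  by apply: eq_bigr => i _; congr t; rewrite /bump /=; lia.
have [|j N|F Fl SF] := @seq_cvg_complete l S; last 1 first.
- suff -> : lsum t = F by [].
  rewrite /lsum; case: xgetP => [G _ SG|/(_ F)//].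
  exact: seq_cvg_unique SG SF.
- by move=> n; apply: tpow_series_sum.
- have [p pP] := t_cvg j N; have [q qP] := t_low.
  exists (p + q)%N => n; elim: n => [|n IHn] pqn.
    have -> : (p + q = 0)%N by lia.
    by rewrite subrr; exact: tpow_series0.
  move: pqn; rewrite leq_eqVlt => /orP[/eqP->|].
    by rewrite subrr; exact: tpow_series0.
  rewrite ltnS => pqn; rewrite SS qP ?add0r; last by lia.
  rewrite lcoefD addrAC; apply: tpow_seriesD; first exact: IHn.
  by apply: pP; lia.
Qed.

Lemma res2_lsum G (c : k) :
  (forall i, res2 (t i * G) = if i == -1 then c else 0) ->
  res2 (lsum t * G) = c.
Proof.
move=> tG; have [_ St] := lsum_cvg.
(* The residue of the sum is that of a late partial sum. Stage [p + 1] is taken because the window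
   is empty at stage 0; index [-1] then sits at position [p]. *)
have [p /(_ p.+1 (leqnSn p)) /=] := res2_seq_to0 G St.
rewrite mulrBl res2D res2N => /eqP; rewrite subr_eq0 => /eqP <-.
rewrite mulr_suml (big_morph (@res2 k) (id1 := 0) (@res2D k))//.
have pp : (p < p.+1.*2)%N by lia.
rewrite (bigD1 (Ordinal pp))//= tG ifT ?big1 ?addr0//; last by lia.
move=> i /negP ip; rewrite tG ifF//; apply/negP => /eqP E; apply: ip.
by apply/eqP/val_inj => /=; lia.
Qed.

End LaurentSum.

Lemma lsum0 : lsum (fun=> 0) = 0 :> {laurent {laurent k}}.
Proof.
have [|||_ S0] := @lsum_cvg 0 (fun=> 0).
- by move=> i; exact: tpow_series0.
- by move=> j N; exists 0%N => i _; exact: tpow_series0.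
- by exists 0%N.
apply: seq_cvg_unique S0 _; split; first by exists 0 => n; rewrite big1 ?subrr.
by move=> j N; exists 0%N => // n _; rewrite /= big1 ?subrr.
Qed.

Lemma res2_lconst (c : k) F : res2 (lconst (lconst c) * F) = c * res2 F.
Proof.
rewrite /res2; have -> : (lconst (lconst c) * F) (-1) = lconst c * F (-1).
  exact: lconst_coef.
exact: lconst_coef.
Qed.

(** * Substituting [f] and [g] into [h] *)

Section Substitution.
Variables f g : {laurent {laurent k}}.
Hypotheses (f_0 : tpow_series 0 f) (f01 : tpow_series 1 (f 0)).
Hypotheses (f01_neq0 : f 0 1 != 0) (g1 : tpow_series 1 g) (g1_neq0 : g 1 != 0).
Implicit Type a : {laurent k}.

Let f00 : f 0 != 0.
Proof. by apply: contraNneq f01_neq0 => ->. Qed.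

(** The leading coefficient [f 0] is invertible in [k((x))], so negative powers of [f] have no pole
    in [y] either. *)
Lemma subst1_term_tpow_series a i :
  tpow_series 0 (lconst (lconst (a i)) * f ^ i).
Proof.
have [fi _] := laurent_exprz_lead i f_0 f00; rewrite mul0r in fi.
rewrite -[0]addr0; exact: tpow_seriesM (@tpow_series_lconst _ _) fi.
Qed.

Lemma subst1_term_cvg a (j N : int) : exists p : nat, forall i : int,
  p%:Z <= i -> tpow_series N ((lconst (lconst (a i)) * f ^ i) j).
Proof.
have [B fB] := tpow_series_exp_coef j f_0 f01.
exists (absz (N + B)) => -[i|i]; last by lia.
move=> iNB; rewrite lconst_coef -exprnP.
apply: tpow_seriesW (tpow_seriesM (@tpow_series_lconst _ _) (fB i)); lia.
Qed.

Lemma subst1_term_low a : exists q : nat, forall i : int,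
  i < - q%:Z -> lconst (lconst (a i)) * f ^ i = 0.
Proof.
by have [q aq] := lcoef_bound a; exists q => i /aq ->; rewrite !lconst0 mul0r.
Qed.

Lemma tpow_series_subst1 a : tpow_series 0 (subst1 a f).
Proof.
by have [] := lsum_cvg (subst1_term_tpow_series a) (subst1_term_cvg a)
  (subst1_term_low a).
Qed.

Lemma subst1_0 : subst1 0 f = 0.
Proof.
rewrite /subst1; under [X in lsum X]funext do rewrite !lconst0 mul0r.
exact: lsum0.
Qed.

(** [res2_lsum] is applied to the sum over [j], then to the inner sum over [i]; the monomial forms
    leave only [h (-1) (-1)]. *)
Lemma res2_change_var h : res2 (change_var f g h) = res2 h.
Proof.
have [q hq] := lcoef_bound h.
have t_low (j : int) : j < - q%:Z -> subst1 (h j) f * g ^ j = 0.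
  by move=> /hq ->; rewrite subst1_0 mul0r.
have t_tpow j : tpow_series j (subst1 (h j) f * g ^ j).
  have [gj _] := laurent_exprz_lead j g1 g1_neq0; rewrite mul1r in gj.
  rewrite -[j]add0r; apply: tpow_seriesM; last by rewrite add0r.
  exact: tpow_series_subst1.
apply: (@res2_lsum (- q%:Z)).
- move=> j; have [/t_low->|qj] := ltP j (- q%:Z); first exact: tpow_series0.
  exact: tpow_seriesW (t_tpow j).
(* Term [i] has [y]-order at least [i], so its [y^j] coefficient is zero once [i > j]. *)
- move=> j N; exists `|j|.+1 => i ji.
  by rewrite t_tpow; [exact: tpow_series0|lia].
- by exists q.
move=> j; rewrite -mulrA.
apply: (res2_lsum (subst1_term_tpow_series _) (subst1_term_cvg _) (subst1_term_low _)).
move=> i; rewrite -mulrA res2_lconst res2_monomial_jacobian//.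
by case: eqP => [->|_]; case: eqP => [->|_]; rewrite ?mulr1 ?mulr0.
Qed.

End Substitution.

End Convergence.

Theorem theorem3p6 (k : fieldType) (h f g : {laurent {laurent k}})
    (f_int : tpow_series 0 f)
    (f0_in : tpow_series 1 (f 0)) (f0_notin : ~ tpow_series 2 (f 0))
    (g_in : tpow_series 1 g) (g_notin : ~ tpow_series 2 g) :
  res2 h = res2 (change_var f g h).
Proof.
have lead_neq0 (R : comNzRingType) (a : {laurent R}) :
    tpow_series 1 a -> ~ tpow_series 2 a -> a 1 != 0.
  move=> a1 a2; apply/eqP => a10; apply: a2 => i i2.
  by have [->//|?] := eqVneq i 1; apply: a1; lia.
by rewrite res2_change_var//; exact: lead_neq0.
Qed.
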